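(* For all integers $1\leq k\leq n$: \[\text{(i)}\quad A_{n,k}=\sum_{r=k-1}^{n-1}(-1)^{n-1-r}\binom{2n-2-r}{k-1}\binom{2n-k}{r+1-k}X_1^{r-2n+1}B_{2n-1-k-r,\;n-1-r},\] \[\text{(ii)}\quad B_{n,k}=\sum_{r=k-1}^{n-1}(-1)^{n-1-r}\binom{2n-2-r}{k-1}\binom{2n-k}{r+1-k}X_1^{2n-1-r}A_{2n-1-k-r,\;n-1-r}.\]
   Context: Let $R=\mathbb{Z}[X_1,X_1^{-1},X_2,X_3,\ldots]$. Partial exponential Bell polynomials: $B_{0,0}=1$, $B_{n,0}=0$ for $n\geq1$, $B_{n,k}=0$ for $0\leq n<k$, and for $1\leq k\leq n$, $B_{n,k}=\sum \frac{n!}{r_1!\cdots r_{n-k+1}!\,(1!)^{r_1}\cdots((n-k+1)!)^{r_{n-k+1}}}X_1^{r_1}\cdots X_{n-k+1}^{r_{n-k+1}}$, summed over nonnegative integers $r_i$ with $\sum r_i=k$, $\sum i r_i=n$. Elements $S_{n,k}\in R$: $S_{0,0}=X_1^{-1}$, $S_{n,0}=0$ ($n\geq1$), $S_{n,k}=0$ ($0\leq n<k$), and for $n\geq0$, $1\leq k\leq n+1$: $S_{n+1,k}=-(2n-1)X_2S_{n,k}+X_1\big(S_{n,k-1}+\sum_{j=1}^{n-k+1}X_{j+1}\,\partial S_{n,k}/\partial X_j\big)$. Set $A_{n,k}:=X_1^{-(2n-1)}S_{n,k}$ (so $A_{0,0}=1$). *)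

(* Defs.v *)
From HB Require Import structures.
From mathcomp Require Import all_boot all_order all_algebra finmap.
From mathcomp Require Import boolp.
From mathcomp Require Import monalg.

Set Implicit Arguments.
Unset Strict Implicit.
Unset Printing Implicit Defensive.

Import GRing.Theory.

Local Open Scope fset_scope.
Local Open Scope ring_scope.

(* The pair (a, m) stands for X_1 ^ a * \prod_(i >= 0) X_(i + 2) ^ (m i).
   [monomType] requires 1 to be the only invertible monomial, so the ring
   structure of {malg int[K]} is not available for these monomials and the
   convolution product is defined here. *)
Definition lmon : Type := (int * {cmonom nat})%type.
HB.instance Definition _ := Choice.on lmon.

Definition lmon1 : lmon := (0, mone).
Definition lmonM (m1 m2 : lmon) : lmon := (m1.1 + m2.1, mmul m1.2 m2.2).

Fact lmonMA : associative lmonM.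
Proof. by case=> a m [b p] [c q]; rewrite /lmonM /= addrA mulmA. Qed.

Fact lmonMC : commutative lmonM.
Proof. by case=> a m [b p]; rewrite /lmonM /= addrC mulmC. Qed.

Fact lmon1M : left_id lmon1 lmonM.
Proof. by case=> a m; rewrite /lmonM /= add0r mul1m. Qed.

(* Z[X_1, X_1^-1, X_2, X_3, ...] *)
Definition lpoly : Type := {malg int[lmon]}.
HB.instance Definition _ := GRing.Zmodule.on lpoly.

Section LpolyRing.
Implicit Types (p q g : lpoly) (k : lmon).

Definition lp1 : lpoly := << 1 *g lmon1 >>.

Definition lpM p q : lpoly :=
  \sum_(k1 <- msupp p) \sum_(k2 <- msupp q)
     << p@_k1 * q@_k2 *g lmonM k1 k2 >>.

Fact lpMC : commutative lpM.
Proof.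
move=> p q; rewrite /lpM exchange_big /=.
by apply: eq_bigr => k1 _; apply: eq_bigr => k2 _; rewrite mulrC lmonMC.
Qed.

Fact lpMw (d1 d2 : {fset lmon}) p q :
  msupp p `<=` d1 -> msupp q `<=` d2 ->
  lpM p q = \sum_(k1 <- d1) \sum_(k2 <- d2)
              << p@_k1 * q@_k2 *g lmonM k1 k2 >>.
Proof.
move=> le_d1 le_d2; rewrite /lpM (big_fset_incl _ le_d1) /=.
  apply/eq_bigr=> k1 _; apply/big_fset_incl => // k _ /mcoeff_outdom ->.
  by rewrite mulr0 monalgU0.
move=> k _ /mcoeff_outdom pk.
by rewrite big1 => // k' _; rewrite pk mul0r monalgU0.
Qed.

Fact lpMDl : left_distributive lpM +%R.
Proof.
move=> p q g.
rewrite [in RHS](lpMw (fsubsetUl _ (msupp q)) (fsubset_refl _)).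
rewrite [in RHS](lpMw (fsubsetUr (msupp p) _) (fsubset_refl _)).
rewrite (lpMw (msuppD_le _ _) (fsubset_refl _)).
rewrite -big_split /=; apply/eq_bigr=> k1 _.
rewrite -big_split /=; apply/eq_bigr=> k2 _.
by rewrite mcoeffD mulrDl monalgUD.
Qed.

Fact lpMDr : right_distributive lpM +%R.
Proof. by move=> p q g; rewrite lpMC lpMDl !(lpMC p). Qed.

Fact lp0M : left_zero 0 lpM.
Proof. by move=> p; rewrite /lpM msupp0 big_seq_fset0. Qed.

Fact lpM0 : right_zero 0 lpM.
Proof. by move=> p; rewrite lpMC lp0M. Qed.

Fact lpMUU c1 c2 k1 k2 :
  lpM << c1 *g k1 >> << c2 *g k2 >> = << c1 * c2 *g lmonM k1 k2 >>.
Proof. by rewrite (lpMw msuppU_le msuppU_le) !big_seq_fset1 !mcoeffUU. Qed.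

Fact lp1M : left_id lp1 lpM.
Proof.
move=> p; rewrite (lpMw msuppU_le (fsubset_refl _)) big_seq_fset1.
rewrite [RHS]monalgE.
by apply/eq_bigr=> k _; rewrite mcoeffUU mul1r lmon1M.
Qed.

Fact lpM_suml (I : Type) (s : seq I) (F : I -> lpoly) q :
  lpM (\sum_(i <- s) F i) q = \sum_(i <- s) lpM (F i) q.
Proof. exact: (big_morph (lpM^~ q) (fun _ _ => lpMDl _ _ _) (lp0M q)). Qed.

Fact lpM_sumr (I : Type) (s : seq I) (F : I -> lpoly) q :
  lpM q (\sum_(i <- s) F i) = \sum_(i <- s) lpM q (F i).
Proof. exact: (big_morph (lpM q) (fun _ _ => lpMDr _ _ _) (lpM0 q)). Qed.

Fact lpMA : associative lpM.
Proof.
move=> p q g.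
have lpMl (f h : lpoly) :
    lpM f h = \sum_(k <- msupp f) lpM << f@_k *g k >> h.
  by rewrite -lpM_suml -monalgE.
have lpMr (f h : lpoly) :
    lpM f h = \sum_(k <- msupp h) lpM f << h@_k *g k >>.
  by rewrite -lpM_sumr -monalgE.
rewrite lpMl [in RHS](lpMl p q) lpM_suml; apply: eq_bigr => k1 _.
rewrite (lpMl q g) lpM_sumr (lpMr _ q) lpM_suml; apply: eq_bigr => k2 _.
rewrite (lpMr _ g) lpM_sumr [RHS]lpMr; apply: eq_bigr => k3 _.
by rewrite !lpMUU mulrA lmonMA.
Qed.

Fact lp1_neq0 : lp1 != 0.
Proof. by rewrite monalgU_eq0. Qed.

End LpolyRing.

HB.instance Definition _ := GRing.Zmodule_isComNzRing.Build lpoly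
  lpMA lpMC lp1M lpMDl lp1_neq0.

Definition lp_unit (p : lpoly) : bool := `[< exists q : lpoly, q * p == 1 >].

Definition lp_inv (p : lpoly) : lpoly :=
  if pselect (exists q : lpoly, q * p == 1) is left ex then xchoose ex else p.

Fact lp_mulVr : {in lp_unit, left_inverse 1 lp_inv *%R}.
Proof.
move=> p /asboolP Up; rewrite /lp_inv; case: pselect => // ex.
exact/eqP/(xchooseP ex).
Qed.

Fact lp_unitPl (p q : lpoly) : q * p = 1 -> lp_unit p.
Proof. by move=> qp; apply/asboolP; exists q; apply/eqP. Qed.

Fact lp_inv_out : {in [predC lp_unit], lp_inv =1 id}.
Proof. by move=> p /asboolPn nUp; rewrite /lp_inv; case: pselect. Qed.

HB.instance Definition _ := GRing.ComNzRing_hasMulInverse.Build lpoly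
  lp_mulVr lp_unitPl lp_inv_out.

(* X_i for i >= 1; there is no variable X_0. *)
Definition lpX (i : nat) : lpoly :=
  match i with
  | 0 => 0
  | 1 => << 1 *g (1, mone) >>
  | j.+2 => << 1 *g (0, ucm j) >>
  end.

Lemma lpX1_unit : lpX 1 \is a GRing.unit.
Proof.
apply: (@lp_unitPl _ << 1 *g ((-1, mone) : lmon) >>).
by rewrite [LHS]lpMUU mulr1 /lmonM /= addNr mul1m.
Qed.

Definition lmon_exp (j : nat) (m : lmon) : int :=
  match j with
  | 0 => 0
  | 1 => m.1
  | i.+2 => (m.2 i)%:Z
  end.

(* m / X_j, when that is a monomial of the ring. *)
Definition lmon_down (j : nat) (m : lmon) : lmon :=
  match j with
  | 0 => m
  | 1 => (m.1 - 1, m.2)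
  | i.+2 => (m.1, divcm m.2 (ucm i))
  end.

(* Partial derivative with respect to X_j, for j >= 1. The truncated division
   in [lmon_down] only matters when the exponent of X_j, hence the
   coefficient, is 0. *)
Definition lpderiv (j : nat) (p : lpoly) : lpoly :=
  \sum_(m <- msupp p) << p@_m * lmon_exp j m *g lmon_down j m >>.

Lemma lpMU (c1 c2 : int) (k1 k2 : lmon) :
  (<< c1 *g k1 >> : lpoly) * << c2 *g k2 >> = << c1 * c2 *g lmonM k1 k2 >>.
Proof. exact: lpMUU. Qed.

Lemma lpderivU j c m :
  lpderiv j << c *g m >> = << c * lmon_exp j m *g lmon_down j m >>.
Proof.
rewrite /lpderiv msuppU; case: eqVneq => [->|_].
  by rewrite big_seq_fset0 mul0r monalgU0.
by rewrite big_seq_fset1 mcoeffUU.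
Qed.

Lemma lpderivw j (d : {fset lmon}) (p : lpoly) : msupp p `<=` d ->
  lpderiv j p = \sum_(m <- d) << p@_m * lmon_exp j m *g lmon_down j m >>.
Proof.
move=> le; apply/big_fset_incl => // k _ /mcoeff_outdom ->.
by rewrite mul0r monalgU0.
Qed.

Lemma lpderivD j : {morph lpderiv j : p q / p + q}.
Proof.
move=> p q; rewrite (lpderivw _ (msuppD_le p q)).
rewrite (lpderivw _ (fsubsetUl (msupp p) (msupp q))).
rewrite (lpderivw _ (fsubsetUr (msupp p) (msupp q))) -big_split /=.
by apply: eq_bigr => m _; rewrite mcoeffD mulrDl monalgUD.
Qed.

Lemma lpderiv0 j : lpderiv j 0 = 0.
Proof. by rewrite /lpderiv msupp0 big_seq_fset0. Qed.

Lemma lpderiv_sum j (I : Type) (s : seq I) (F : I -> lpoly) :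
  lpderiv j (\sum_(i <- s) F i) = \sum_(i <- s) lpderiv j (F i).
Proof. exact: (big_morph (lpderiv j) (lpderivD j) (lpderiv0 j)). Qed.

Fact lmon_downM j k1 k2 : lmon_exp j k1 != 0 ->
  lmon_down j (lmonM k1 k2) = lmonM (lmon_down j k1) k2.
Proof.
case: k1 k2 => a m [b n]; case: j => [|[|j]] //= nz; rewrite /lmonM /=.
  by congr pair; rewrite addrAC.
congr pair; apply/eqP/cmP => i; rewrite divcmE !mulcmE divcmE ucmE.
by have [<-|_] := eqVneq j i; rewrite ?subn0 // addnBAC // lt0n.
Qed.

Fact lmon_expM j k1 k2 :
  lmon_exp j (lmonM k1 k2) = lmon_exp j k1 + lmon_exp j k2.
Proof.
by case: k1 k2 => a m [b n]; case: j => [|[|j]] //=; rewrite mulcmE PoszD.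
Qed.

Fact lpderivMU j (c1 c2 : int) (k1 k2 : lmon) :
  let u : lpoly := << c1 *g k1 >> in let v : lpoly := << c2 *g k2 >> in
  lpderiv j (u * v) = lpderiv j u * v + u * lpderiv j v.
Proof.
move=> u v; rewrite /u /v lpMU !lpderivU !lpMU lmon_expM mulrDr monalgUD.
congr (_ + _).
  have [->|nz] := eqVneq (lmon_exp j k1) 0.
    by rewrite !(mulr0, mul0r) !monalgU0.
  by rewrite (lmon_downM _ nz) mulrAC.
have [->|nz] := eqVneq (lmon_exp j k2) 0.
  by rewrite !(mulr0, mul0r) !monalgU0.
by rewrite [lmonM k1 k2]lmonMC (lmon_downM _ nz) [lmonM k1 _]lmonMC mulrA.
Qed.

Lemma lpderivM j (p q : lpoly) :
  lpderiv j (p * q) = lpderiv j p * q + p * lpderiv j q.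
Proof.
have E (f : lpoly) : exists s : seq (int * lmon),
    f = \sum_(i <- s) (<< i.1 *g i.2 >> : lpoly).
  by exists [seq (f@_k, k) | k <- msupp f]; rewrite big_map; exact: monalgE.
have [s ->] := E p; have [t ->] := E q; set q0 := \sum_(i <- t) _.
rewrite [in RHS]lpderiv_sum !mulr_suml -big_split /= lpderiv_sum.
apply: eq_bigr => i _.
rewrite /q0 [in RHS]lpderiv_sum !mulr_sumr -big_split /= lpderiv_sum.
by apply: eq_bigr => l _; exact: lpderivMU.
Qed.

Lemma lpderivX i j : lpderiv i.+1 (lpX j.+1) = (i == j)%:R.
Proof.
have z k : << 0 *g k >> = 0 :> lpoly by exact: monalgU0.
case: i j => [|i] [|j]; rewrite [lpX _]/= lpderivU.
- by rewrite [lmon_exp _ _]/= mul1r /lmon_down subrr.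
- by rewrite [lmon_exp _ _]/= mulr0 z.
- by rewrite [lmon_exp _ _]/= onecmE mulr0 z.
rewrite [lmon_exp _ _]/= mul1r ucmE eqSS eq_sym.
have [->|_] := eqVneq i j; last by rewrite z.
have -> : lmon_down j.+2 (0, ucm j) = lmon1.
  by congr pair; apply/eqP/cmP => k; rewrite divcmE subnn onecmE.
by [].
Qed.

(* The index i of [r] is that of X_(i + 1), and the r_i are at most k because
   they sum to k. The natural number division is exact: the quotient counts
   the partitions of an n-element set with r_i blocks of size i for all i. *)
Definition Bell (n k : nat) : lpoly :=
  if k == 0%N then (n == 0%N)%:R
  else if (n < k)%N then 0
  else \sum_(r : {ffun 'I_(n - k).+1 -> 'I_k.+1}
              | ((\sum_i r i)%N == k)
                && ((\sum_(i < (n - k).+1) i.+1 * r i)%N == n))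
         (n`! %/ (\prod_i (r i)`! * \prod_(i < (n - k).+1) i.+1`! ^ r i))%:R
           * \prod_(i < (n - k).+1) lpX i.+1 ^+ r i.

Fixpoint Spoly (n k : nat) : lpoly :=
  match n with
  | 0 => if k == 0%N then (lpX 1)^-1 else 0
  | n'.+1 =>
    if (0 < k <= n'.+1)%N then
      - (((2 * n')%:Z - 1)%:~R * lpX 2 * Spoly n' k)
      + lpX 1 * (Spoly n' k.-1
                 + \sum_(1 <= j < (n'.+1 - k).+1)
                     lpX j.+1 * lpderiv j (Spoly n' k))
    else 0
  end.

Definition Apoly (n k : nat) : lpoly := lpX 1 ^ (1 - (2 * n)%:Z) * Spoly n k.

(* Main.v *)
Require Import Defs.
From mathcomp Require Import all_boot all_order all_algebra.
From mathcomp Require Import finmap monalg.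
From mathcomp Require Import ring zify.

(* Let d be the derivation with d X_j = X_(j+1), and x = X_1. The Bell
   polynomials satisfy B(n+1,k) = x B(n,k-1) + d B(n,k), and the A(n,k) satisfy
   the same recurrence for the pair (x^-1, x^-1 d) in place of (x, d). Passing
   from (x, d) to (x^-1, x^-1 d) is an involution, so that (ii) is (i) for the
   other pair. For (i), let C(n,k) be the Bell polynomials in the variables
   X_2, X_3, ... only. Both B and A are combinations of the C:
     B(n,k) = \sum_j binom(n,j) x^j C(n-j,k-j),
     A(n,k) = \sum_s (-1)^s binom(n-1+s,k-1) x^(-n-s) C(n-k+s,s),
   each by induction on n from d C(n,k) = C(n+1,k) - n X_2 C(n-1,k-1), and (i)
   follows by comparing the coefficients of the C. *)

Set Implicit Arguments.
Unset Strict Implicit.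
Unset Printing Implicit Defensive.

Import GRing.Theory.

Local Open Scope ring_scope.

(** * Recurrences over a ring with a derivation *)

Section Derivation.
Variables (R : comNzRingType) (d : R -> R).

Definition derivation : Prop :=
  {morph d : u v / u + v} /\ forall u v, d (u * v) = d u * v + u * d v.

Hypothesis derd : derivation.

Lemma derD : {morph d : u v / u + v}. Proof. by case: derd. Qed.

Lemma derM u v : d (u * v) = d u * v + u * d v. Proof. by case: derd. Qed.

Lemma der0 : d 0 = 0.
Proof. by apply: (addrI (d 0)); rewrite -derD !addr0. Qed.

Lemma der1 : d 1 = 0.
Proof.
by apply: (addrI (d 1)); rewrite -[in RHS](mulr1 1) derM mulr1 mul1r addr0.
Qed.

Lemma derN u : d (- u) = - d u.
Proof. by apply: (addrI (d u)); rewrite -derD !subrr der0. Qed.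

Lemma der_sum (I : Type) (s : seq I) (P : pred I) (F : I -> R) :
  d (\sum_(i <- s | P i) F i) = \sum_(i <- s | P i) d (F i).
Proof. exact: (big_morph d derD der0). Qed.

Lemma der_nat n : d n%:R = 0.
Proof. by elim: n => [|n IH]; rewrite ?der0 // mulrSr derD IH der1 addr0. Qed.

Lemma der_natM n u : d (n%:R * u) = n%:R * d u.
Proof. by rewrite derM der_nat mul0r add0r. Qed.

Lemma der_signM n u : d ((-1) ^+ n * u) = (-1) ^+ n * d u.
Proof.
by elim: n => [|n IH]; rewrite ?mul1r // exprS !mulN1r !mulNr derN IH.
Qed.

Lemma derX n u : d (u ^+ n) = n%:R * u ^+ n.-1 * d u.
Proof.
elim: n => [|n IH]; first by rewrite der1 !mul0r.
rewrite exprS derM IH [n.+1.-1]/=; case: n {IH} => [|n]; first by ring.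
by rewrite exprS; ring.
Qed.

Lemma der_inv x y : x * y = 1 -> d y = - (y ^+ 2 * d x).
Proof.
move=> xy1; have /(congr1 (fun u => y * u)) : d (x * y) = 0 by rewrite xy1 der1.
rewrite derM mulrDr mulr0 mulrA (mulrA y x) [y * x]mulrC xy1 mul1r => /eqP.
by rewrite addr_eq0 => /eqP E; rewrite -[d y]opprK -E; ring.
Qed.

End Derivation.

Lemma derivation_scale (R : comNzRingType) (d : R -> R) (y : R) :
  derivation d -> derivation (fun u => y * d u).
Proof.
by move=> derd; split=> u v; rewrite ?(derD derd) ?(derM derd); ring.
Qed.

(** * Bell polynomials of a pair (x, d), and their part free of x *)

Section BellRec.
Variable R : comNzRingType.
Implicit Types (x y : R) (d : R -> R).

(** Both x and d are arguments, so that B and A become two instances of one recurrence. *)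
Fixpoint bell x d n k : R :=
  match n with
  | 0 => (k == 0%N)%:R
  | m.+1 => (if k is j.+1 then x * bell x d m j else 0) + d (bell x d m k)
  end.

Lemma eq_bell x d1 d2 n k : d1 =1 d2 -> bell x d1 n k = bell x d2 n k.
Proof.
move=> eqd; elim: n k => //= n IH k; rewrite IH eqd.
by case: k => // k; rewrite IH.
Qed.

Lemma bellS x d n k :
  bell x d n.+1 k.+1 = x * bell x d n k + d (bell x d n k.+1).
Proof. by []. Qed.

(* The part of [bell x d n k] of degree 0 in x. *)
Fixpoint abell x d n k : R :=
  match n with
  | 0 => (k == 0%N)%:R
  | m.+1 => d (abell x d m k) +
      match m, k with
      | l.+1, j.+1 => m%:R * d x * abell x d l j
      | _, _ => 0
      end
  end.

Variables (x : R) (d : R -> R).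
Hypothesis derd : derivation d.

Local Notation B := (bell x d).
Local Notation C := (abell x d).

Lemma bell_lt n k : (n < k)%N -> B n k = 0.
Proof.
elim: n k => [|n IH] [|k] //= ltnk.
by rewrite !IH ?mulr0 ?(der0 derd) ?addr0 //; lia.
Qed.

Lemma bell0 n : B n 0 = (n == 0%N)%:R.
Proof.
elim: n => //= n ->; rewrite add0r.
by case: n => [|n]; rewrite ?(der1 derd) ?(der0 derd).
Qed.

Lemma abellS n k : C n.+1 k.+1 = d (C n k.+1) + n%:R * d x * C n.-1 k.
Proof. by case: n => [|n] //=; rewrite !mul0r. Qed.

Lemma abellS0 n : C n.+1 0 = d (C n 0).
Proof. by case: n => [|n] /=; rewrite addr0. Qed.

(** Each of the k blocks has size at least 2. The induction is strong because [abellS] reaches back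
    two steps. *)
Lemma abell_small n k : (n < k.*2)%N -> C n k = 0.
Proof.
have [m] := ubnP n; elim: m n k => // m IH [|n] [|k] // ltnm ltnk.
rewrite abellS IH ?(der0 derd) ?add0r; [|lia|lia].
case: n ltnm ltnk => [|n] ltnm ltnk; first by rewrite !mul0r.
by rewrite IH ?mulr0 //; lia.
Qed.

(** Here j is the number of singletons in a partition; the other blocks have size at least 2. *)
Lemma bell_abell n k :
  B n k = \sum_(j < k.+1) 'C(n, j)%:R * x ^+ j * C (n - j)%N (k - j)%N.
Proof.
elim: n k => [|n IH] k.
  rewrite big_ord_recl big1 ?addr0 => [|i _]; last by rewrite bin0n !mul0r.
  by rewrite /= bin0 expr0 !mul1r subn0.
case: k => [|k]; rewrite [LHS]/=.
  by rewrite add0r IH !big_ord1 !bin0 !subn0 !mul1r abellS0.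

(* Pascal's rule splits the sum into [x * B n k] and the sum of the [p i]. Then [abellS] splits
   [p i] into [f i], where d falls on C, and [g i], which is what d yields on the factor [x ^+ i.+1]
   in the summand i + 1 of [B n k.+1]. *)
pose p i := 'C(n, i)%:R * x ^+ i * C (n.+1 - i)%N (k.+1 - i)%N.
pose f i := 'C(n, i)%:R * x ^+ i * d (C (n - i)%N (k.+1 - i)%N).
pose g i := 'C(n, i)%:R * (n - i)%:R * x ^+ i * d x * C (n - i).-1 (k - i)%N.
have pE i : (i < k.+1)%N -> p i = f i + g i.
  rewrite ltnS => leik; rewrite /p /f /g (subSn leik).
  have [lein|ltni] := leqP i n; last by rewrite bin_small // !mul0r addr0.
  by rewrite subSn // abellS; ring.
have pE_last : p k.+1 = f k.+1.
  rewrite /p /f subnn.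
  have [lein|ltni] := leqP k.+1 n; last by rewrite bin_small // !mul0r.
  by rewrite subSn // abellS0.
have -> : \sum_(i < k.+2)
      'C(n.+1, i)%:R * x ^+ i * C (n.+1 - i)%N (k.+1 - i)%N =
    x * B n k + \sum_(i < k.+2) p i.
  rewrite !(big_ord_recl k.+1) addrCA; congr (_ + _).
    by rewrite /p !bin0.
  rewrite IH mulr_sumr -big_split; apply: eq_bigr => i _.
  by rewrite /p !lift0 !subSS binS natrD exprS /=; ring.
congr (_ + _); rewrite big_ord_recr pE_last /=.
under eq_bigr => i _ do rewrite pE //.
rewrite big_split addrAC /=.
rewrite -[_ + f k.+1](big_ord_recr _ (fun i : 'I_k.+2 => f i)).
rewrite IH (der_sum derd).
have dE i : d ('C(n, i)%:R * x ^+ i * C (n - i)%N (k.+1 - i)%N) =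
    f i + 'C(n, i)%:R * i%:R * x ^+ i.-1 * d x * C (n - i)%N (k.+1 - i)%N.
  by rewrite -mulrA (der_natM derd) (derM derd) (derX derd) /f; ring.
rewrite [LHS](eq_bigr _ (fun (i : 'I_k.+2) _ => dE i)).
rewrite big_split /=; congr (_ + _).
rewrite [LHS]big_ord_recl mulr0 !mul0r add0r; apply: eq_bigr => i _.
rewrite /g !lift0 subnS subSS; congr (_ * _ * _ * _).
by rewrite -!natrM mulnC mul_bin_left mulnC.
Qed.

End BellRec.

(** Compare the coefficients of z^m in (1+z)^(a+b) (1+z)^(-a) = (1+z)^b. For a = 0 the truncated
    predecessor leaves only the term u = 0. *)
Lemma sum_alt_binM (a b m : nat) :
  \sum_(u < m.+1) (-1) ^+ u * ('C(a + b, m - u) * 'C((a + u).-1, u))%:R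
  = 'C(b, m)%:R :> int.
Proof.
elim: a => [|a IH].
  rewrite big_ord_recl big1 => [|i _].
    by rewrite bin0 muln1 mul1r subn0 add0n addr0.
  by rewrite lift0 add0n (@bin_small i.+1.-1) // muln0 mulr0.
rewrite -IH {IH}.
(* By Pascal's rule the summands for a + 1 and for a are sums of the same f and g, up to a shift of
   the index of f. *)
pose f u : int := (-1) ^+ u * ('C(a + b, m - u) * 'C(a + u, u))%:R.
pose g u : int := (-1) ^+ u * ('C(a + b, m - u.+1) * 'C(a + u, u))%:R.
have lhsE (u : 'I_m) : (-1) ^+ u *
    ('C(a.+1 + b, m - u) * 'C((a.+1 + u).-1, u))%:R = f u + g u.
  rewrite /f /g -mulrDr -natrD -mulnDl addSn /=.
  by rewrite -[(m - u)%N](subnSK (ltn_ord u)) binS addnC.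
have rhsE u : (-1) ^+ u.+1 *
    ('C(a + b, m - u.+1) * 'C((a + u.+1).-1, u.+1))%:R = f u.+1 + g u.
  rewrite /f /g addnS binS mulnDr natrD !exprS; ring.
rewrite big_ord_recr [RHS]big_ord_recl /= (eq_bigr _ (fun i _ => lhsE i)).
rewrite subnn !bin0 mul1n big_split /= addrAC.
under [in RHS]eq_bigr => i _ do rewrite /bump add1n rhsE.
rewrite big_split /= addrA; congr (_ + _).
transitivity (\sum_(u < m.+1) f u).
  by rewrite big_ord_recr /f /= subnn bin0 mul1n.
by rewrite big_ord_recl /f /= !bin0.
Qed.

(** Both sides count the pairs of disjoint subsets of sizes a and b in an n-element set. *)
Lemma mul_bin_sub n a b :
  ('C(n, a) * 'C(n - a, b) = 'C(n, a + b) * 'C(a + b, b))%N.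
Proof.
have [le_abn|lt_nab] := leqP (a + b) n; last first.
  rewrite [X in (_ = X * _)%N]bin_small // mul0n.
  have [le_an|lt_na] := leqP a n; last by rewrite bin_small.
  by rewrite ['C(n - a, b)]bin_small ?muln0 //; lia.
have -> : n = (n - (a + b) + b + a)%N by lia.
set p := (n - (a + b))%N; rewrite addnK -addnA [(b + a)%N]addnC.
have pos i : (0 < i`!)%N by exact: fact_gt0.
have E i j : ('C(i + j, j) * (j`! * i`!) = (i + j)`!)%N.
  by rewrite -[X in (j`! * X`!)%N](addnK j i) bin_fact // leq_addl.
apply/eqP; rewrite -(eqn_pmul2r (pos p)) -(eqn_pmul2r (pos a)).
rewrite -(eqn_pmul2r (pos b)); apply/eqP.
transitivity ((p + (a + b))`!)%N; last by rewrite -E -(E a b); lia.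
by rewrite [(a + b)%N]addnC addnA -E -(E p b); lia.
Qed.

(** Both sides are the multinomial coefficient (p+u+k)! / (p! u! k!). *)
Lemma bin_trinomial p u k :
  ('C(p + u + k, k) * 'C(p + u, u) = 'C(p + k, k) * 'C(p + k + u, u))%N.
Proof.
have := mul_bin_sub (p + u + k) k u; rewrite addnK => ->.
rewrite [RHS]mulnC.
have := mul_bin_sub (p + k + u) u k; rewrite addnK => ->.
rewrite addnAC [(u + k)%N]addnC; congr (_ * _)%N.
by rewrite -[LHS]bin_sub ?leq_addl // addnK.
Qed.

Lemma sum_nat_shift (V : nmodType) (F : nat -> V) (a b : nat) :
  \sum_(a <= i < b) F i = \sum_(i < b - a) F (i + a)%N.
Proof. by rewrite -{1}[a]add0n big_addn big_mkord. Qed.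

(** * Expansion and inversion for the pair (y, y d), where x y = 1 *)

Section Inversion.
Variables (R : comNzRingType) (x y : R) (d : R -> R).
Hypotheses (derd : derivation d) (xy1 : x * y = 1).

Local Notation B := (bell x d).
Local Notation C := (abell x d).

Local Notation d' := (fun u => y * d u).

Lemma bell_diag z (e : R -> R) n : derivation e -> bell z e n n = z ^+ n.
Proof.
move=> dere; elim: n => //= n ->.
by rewrite bell_lt // (der0 dere) addr0 exprS.
Qed.

(** The indices m + k + 1 and k + 1 avoid truncated subtraction. The induction is on m + k, which
    drops by one in both terms of [bellS]. *)
Lemma bell_comtet m k :
  bell y d' (m + k).+1 k.+1 =
  \sum_(s < m.+1)
     (-1) ^+ s * 'C(m + k + s, k)%:R * y ^+ (m + k + s).+1 * C (m + s)%N s.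
Proof.
have derd' : derivation d' by exact: derivation_scale.
have [N] := ubnP (m + k); elim: N m k => // N IH [|m] k ltN.
  by rewrite big_ord1 add0n bell_diag // addn0 binn !mul1r mulr1.
(* In y d T, the part [T1] comes from the leading term of d C, [h] from d falling on the power of y,
   and [g] from the correction term in [abellS]. Since [h s = - g s.+1], the last two telescope
   away; [T1] combines with the other term of [bellS] by Pascal's rule. *)
pose T k m s :=
  (-1) ^+ s * 'C(m + k + s, k)%:R * y ^+ (m + k + s).+1 * C (m + s)%N s.
pose T1 s :=
  (-1) ^+ s * 'C(m + k + s, k)%:R * y ^+ (m + k + s).+2 * C (m.+1 + s)%N s.
pose h s := (-1) ^+ s * ('C(m + k + s, k)%:R * (m + k + s).+1%:R) *
  y ^+ (m + k + s).+3 * d x * C (m + s)%N s.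
pose g s := if s is r.+1 then (-1) ^+ s * ('C(m + k + s, k)%:R * (m + s)%:R) *
  y ^+ (m + k + s).+2 * d x * C (m + r)%N r else 0.
have first s : T k m.+1 s =
    T1 s + y * (if k is j.+1 then T j m.+1 s else 0).
  rewrite /T /T1; case: (k) => [|j].
    by rewrite !bin0 mulr0 addr0 !addn0 !addSn.
  by rewrite !(addSn, addnS) binS natrD !exprS; ring.
have second s : d' (T k m s) = T1 s - h s - g s.
  rewrite -[LHS]/(y * d (T k m s)) /T -!mulrA (der_signM derd).
  rewrite (der_natM derd) (derM derd) (derX derd).
  rewrite (der_inv derd xy1) /T1 /h /g !addSn !exprS -pred_Sn.
  case: s => [|r]; first by rewrite addn0 abellS0; ring.
  by rewrite abellS !addnS exprS /=; ring.
have telescope s : h s = - g s.+1.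
  rewrite /g /h !addnS [(-1) ^+ s.+1]exprS mulN1r !mulNr opprK.
  congr (_ * _ * _ * _ * _).
  rewrite -!natrM; congr (_ %:R).
  have := mul_bin_down (m + k + s).+1 k; rewrite /=.
  have -> : ((m + k + s).+1 - k = (m + s).+1)%N by lia.
  lia.
(* The added index s = m + 1 contributes nothing, because C(2m+1, m+1) = 0. *)
have lead : bell y d' (m.+1 + k) k.+1 = \sum_(s < m.+2) T k m s.
  rewrite big_ord_recr [RHS]/= [T k m m.+1]/T.
  rewrite (abell_small x derd) ?mulr0 ?addr0; last by lia.
  by rewrite addSn; apply: IH; lia.
have cancel : \sum_(s < m.+2) h s + \sum_(s < m.+2) g s = 0.
  rewrite big_ord_recr [\sum_(s < m.+2) g s]big_ord_recl /=.
  rewrite [h m.+1]/h (abell_small x derd) ?mulr0 ?addr0 ?add0r; last by lia.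
  by rewrite -big_split big1 // => i _; rewrite telescope /= addNr.
rewrite bellS lead (der_sum derd').
rewrite (eq_bigr _ (fun (i : 'I_m.+2) _ => second i)).
rewrite !sumrB -addrA -opprD cancel subr0.
rewrite [RHS](eq_bigr _ (fun (i : 'I_m.+2) _ => first i)).
rewrite big_split -mulr_sumr [RHS]addrC; congr (_ * _ + _).
case: k {T1 h g first second telescope lead cancel} ltN => [|k] ltN.
  by rewrite bell0 // big1.
by rewrite addnS; apply: IH; lia.
Qed.

(** This is (i) with s = n - 1 - r. Expand B by [bell_abell] and compare the coefficients of C(m+t,
    t) with those in [bell_comtet]. *)
Lemma bell_inversion_shift m k :
  bell y d' (m + k).+1 k.+1 =
  \sum_(s < m.+1)
     (-1) ^+ s * 'C(m + k + s, k)%:R * 'C((m + m + k).+1, m - s)%:R *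
     y ^+ (m + k + s).+1 * B (m + s)%N s.
Proof.
pose c s := (-1) ^+ s * 'C(m + k + s, k)%:R * 'C((m + m + k).+1, m - s)%:R *
  y ^+ (m + k + s).+1 : R.
pose e s t := c s * ('C(m + s, s - t)%:R * x ^+ (s - t) * C (m + t)%N t).
have rowE (s : 'I_m.+1) : true ->
    c s * B (m + s)%N s = \sum_(0 <= t < m.+1 | (t <= s)%N) e s t.
  move=> _; have le_sm := ltn_ord s.
  have -> : \sum_(0 <= t < m.+1 | (t <= s)%N) e s t =
      \sum_(0 <= t < s.+1) e s t.
    by rewrite (big_nat_widen 0 s.+1 m.+1).
  (* Reversal replaces the number of singletons by the number t of larger blocks, so that C(m+t, t)
     no longer depends on s. *)
  rewrite bell_abell // (reindex_inj rev_ord_inj) mulr_sumr big_mkord.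
  apply: eq_bigr => t _; have le_ts : (t <= s)%N by rewrite -ltnS.
  rewrite /e [nat_of_ord (rev_ord t)]/= subSS subKn //.
  by rewrite -addnBA ?leq_subr // subKn.
pose row s := \sum_(0 <= t < m.+1 | (t <= s)%N) e s t.
rewrite bell_comtet [RHS](eq_bigr _ rowE) -[RHS](big_mkord predT row) {}/row.
rewrite (exchange_big_dep_nat predT) // [RHS]big_mkord.
apply: eq_bigr => t _; have le_tm : (t <= m)%N by rewrite -ltnS.
rewrite -(@big_nat_widenl _ _ _ t 0 m.+1 predT) //.
rewrite sum_nat_shift subSn //.
have yx i : y ^+ i * x ^+ i = 1 by rewrite -exprMn mulrC xy1 expr1n.
(* With u = s - t, [bin_trinomial] moves the dependence on k into a factor free of u; the remaining
   alternating sum is 'C(m - t, m - t) = 1 by [sum_alt_binM]. *)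
transitivity (\sum_(u < (m - t).+1) (-1) ^+ t * 'C(m + k + t, k)%:R *
    y ^+ (m + k + t).+1 * C (m + t)%N t * ((-1) ^+ u *
    ('C((m + k + t).+1 + (m - t), m - t - u) *
     'C(((m + k + t).+1 + u).-1, u))%:R)).
  rewrite -mulr_sumr.
  have := sum_alt_binM (m + k + t).+1 (m - t) (m - t).
  move/(congr1 (fun z : int => z%:~R : R)).
  rewrite binn rmorph_sum => E; rewrite -[LHS]mulr1; congr (_ * _).
  apply: etrans (esym E) _; apply: eq_bigr => u _.
  by rewrite rmorphM rmorphXn rmorphN1 rmorph_nat.
apply: eq_bigr => u _; rewrite /e /c addnK.
have -> : ((m + k + t).+1 + (m - t) = (m + m + k).+1)%N by lia.
have -> : (m - (u + t) = m - t - u)%N by lia.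
have -> : (m + k + (u + t) = m + t + u + k)%N by lia.
have -> : (m + (u + t) = m + t + u)%N by lia.
rewrite addSn /=.
have -> : ((m + t + u + k).+1 = (m + k + t).+1 + u)%N by lia.
have -> : (m + k + t = m + t + k)%N by lia.
have/(congr1 (fun n => n%:R : R)) := bin_trinomial (m + t) u k.
rewrite !natrM => tri.
rewrite !exprD.
transitivity ((-1) ^+ t * (-1) ^+ u *
   ('C(m + t + u + k, k)%:R * 'C(m + t + u, u)%:R) *
   'C((m + m + k).+1, m - t - u)%:R * y ^+ (m + t + k).+1 *
   (y ^+ u * x ^+ u) * C (m + t)%N t).
  by rewrite tri yx; ring.
by ring.
Qed.
End Inversion.

(** * The explicit formula for Bell polynomials *)

(* The number of partitions of a set of [i.+1 * t] elements into t blocks of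
   size i.+1. *)
Fixpoint blocks i t : nat :=
  if t is s.+1 then ('C(i.+1 * s + i, i) * blocks i s)%N else 1%N.

Lemma blocks_fact i t : (blocks i t * (t`! * i.+1`! ^ t) = (i.+1 * t)`!)%N.
Proof.
elim: t => [|t IH]; first by rewrite muln0.
rewrite [blocks _ _]/= expnS.
have -> : (i.+1 * t.+1 = (i.+1 * t + i).+1)%N by lia.
rewrite [RHS]factS -(bin_fact (leq_addl (i.+1 * t) i)) addnK -IH.
by set w := (_ ^ t)%N; rewrite !factS -addnS -mulnSr; ring.
Qed.

(** Both sides count the partitions into t + 1 blocks with one block marked. *)
Lemma blocksS i t :
  (blocks i t.+1 * t.+1 = 'C(i.+1 * t + i.+1, i.+1) * blocks i t)%N.
Proof.
apply/eqP; rewrite -(eqn_pmul2l (ltn0Sn i)) /=; apply/eqP.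
rewrite [RHS]mulnA -mul_bin_diag addnS -pred_Sn -addnS -mulnSr; ring.
Qed.

(** * Bell polynomials with bounded block size *)

Section PartialBell.
Variables (R : comNzRingType) (X : nat -> R).

(* The partial Bell polynomial restricted to the blocks of size at most M; the
   summation index t is the number of blocks of size M. *)
Fixpoint pbell M n k : R :=
  if M is m.+1 then
    \sum_(t < k.+1) ('C(n, m.+1 * t) * blocks m t)%:R * X m.+1 ^+ t *
      pbell m (n - m.+1 * t)%N (k - t)%N
  else ((n == 0%N) && (k == 0%N))%:R.

Lemma pbellS M n k : pbell M.+1 n k =
  \sum_(t < k.+1) ('C(n, M.+1 * t) * blocks M t)%:R * X M.+1 ^+ t *
    pbell M (n - M.+1 * t)%N (k - t)%N.
Proof. by []. Qed.

Lemma pbell_lt M n k : (n < k)%N -> pbell M n k = 0.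
Proof.
elim: M n k => [|M IH] n k lt_nk /=.
  by case: k lt_nk => // k; rewrite andbF.
apply: big1 => t _; have [le|lt] := leqP (M.+1 * t) n.
  by rewrite IH ?mulr0 //; nia.
by rewrite bin_small // !mul0r.
Qed.

(** A block of size M + 1 would leave fewer than k - 1 elements for the k - 1 other blocks. *)
Lemma pbellS_stable M n k : (n < M + k)%N -> pbell M.+1 n k = pbell M n k.
Proof.
move=> lt_n /=; rewrite big_ord_recl big1 => [|t _].
  by rewrite muln0 !subn0 bin0 !mul1r addr0.
rewrite lift0; have [le|lt] := leqP (M.+1 * t.+1) n; last first.
  by rewrite bin_small // !mul0r.
by rewrite pbell_lt ?mulr0 //; have := ltn_ord t; nia.
Qed.

Lemma pbell_stable M N n k : (n < M + k)%N -> (M <= N)%N ->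
  pbell N n k = pbell M n k.
Proof.
move=> lt_n /subnK <-; elim: (N - M)%N => // j IH.
by rewrite addSn pbellS_stable ?IH //; lia.
Qed.

Variable d : R -> R.
Hypothesis derd : derivation d.

(** A new element is either a singleton or joins a block, which is what d encodes. The extra term on
    the left accounts for joining a block of size M, whose result exceeds the bound. *)
Lemma pbell_rec M n k : (forall j, (0 < j <= M)%N -> d (X j) = X j.+1) ->
  pbell M n.+1 k +
    (if k is j.+1 then 'C(n, M)%:R * X M.+1 * pbell M (n - M)%N j else 0)
  = d (pbell M n k) + (if k is j.+1 then X 1%N * pbell M n j else 0).
Proof.
elim: M n k => [|M IH] n k dX.
  rewrite /= (der_nat derd) !add0r; case: k => // k.
  by rewrite subn0 bin0 mul1r.
have dXle i : (0 < i <= M)%N -> (0 < i <= M.+1)%N by lia.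
have {}IH l j : _ := IH l j (fun i le_i => dX i (dXle i le_i)).
have dXM : d (X M.+1) = X M.+2 by apply: dX; lia.
set m := M.+1 in dXM *.
(* Differentiating the summand t of [pbellS] gives [f] from the power of [X m]; the induction
   hypothesis turns the rest into [a], the over-large blocks [b] and the singletons [e]. The tests t
   < k replace the match on k - t. *)
pose c t : R := ('C(n, m * t) * blocks M t)%:R * X m ^+ t.
pose a t := c t * pbell M (n - m * t).+1 (k - t)%N.
pose b t := if (t < k)%N then
    c t * ('C(n - m * t, M)%:R * X m *
      pbell M (n - m * t - M)%N (k - t.+1)%N) else 0.
pose e t := if (t < k)%N then
    c t * (X 1%N * pbell M (n - m * t)%N (k - t.+1)%N) else 0.
pose f t := ('C(n, m * t) * blocks M t)%:R * t%:R * X m ^+ t.-1 * X m.+1 *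
  pbell M (n - m * t)%N (k - t)%N.
have dE t : (t < k.+1)%N -> d (c t * pbell M (n - m * t)%N (k - t)%N) =
    a t + b t - e t + f t.
  rewrite ltnS => le_tk; have := IH (n - m * t)%N (k - t)%N.
  rewrite /a /b /e /f /c (derM derd) (der_natM derd) (derX derd) dXM.
  case: ltnP => [lt_tk|ge_tk].
    by rewrite -(subnSK lt_tk) => /(canRL (addrK _)) ->; ring.
  have -> : (k - t = 0)%N by lia.
  by rewrite !addr0 => ->; ring.
rewrite -[pbell m n k]/(\sum_(t < k.+1) c t * pbell M (n - m * t)%N (k - t)%N).
rewrite (der_sum derd).
rewrite [in RHS](eq_bigr _ (fun (i : 'I_k.+1) _ => dE i (ltn_ord i))).
rewrite big_split sumrB big_split /=.
have sum_e : \sum_(t < k.+1) e t = if k is j.+1 then X 1%N * pbell m n j else 0.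
  rewrite /e; case: (k) => [|j]; first by rewrite big1.
  rewrite big_ord_recr ltnn [LHS]addr0 [pbell m _ _]pbellS mulr_sumr.
  apply: eq_bigr => t _.
  by rewrite [(_ < _)%N](ltn_ord t) /c subSS mulrCA mulrA.
have sum_f : \sum_(t < k.+1) f t =
    if k is j.+1 then 'C(n, m)%:R * X m.+1 * pbell m (n - m)%N j else 0.
  rewrite big_ord_recl {1}/f mulr0 !mul0r [LHS]add0r.
  rewrite /f; case: (k) => [|j]; first by rewrite big_ord0.
  rewrite [pbell m _ _]pbellS mulr_sumr; apply: eq_bigr => t _.
  rewrite lift0 subSS.
  have -> : (n - m * t.+1 = n - m - m * t)%N by lia.
  rewrite -natrM.
  have -> : ('C(n, m * t.+1) * blocks M t.+1 * t.+1 =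
      'C(n, m) * ('C(n - m, m * t) * blocks M t))%N.
    rewrite -mulnA blocksS [RHS]mulnA mul_bin_sub -mulnA -/m.
    have -> : (m + m * t = m * t.+1)%N by lia.
    have -> : 'C(m * t.+1, m * t) = 'C(m * t.+1, m).
      by rewrite -[RHS]bin_sub; [congr 'C(_, _); lia | lia].
    by have -> : (m * t + m = m * t.+1)%N by lia.
  by rewrite natrM -pred_Sn -/m; ring.
(* Pascal's rule asks whether the new element lies in a block of size m: [a] if not, [b] if so. *)
have sum_ab : pbell m n.+1 k = \sum_(t < k.+1) a t + \sum_(t < k.+1) b t.
  have b_last : b k = 0 by rewrite /b ltnn.
  rewrite [pbell m _ _]pbellS big_ord_recl [\sum_(t < _) a t]big_ord_recl.
  rewrite [\sum_(t < _) b t]big_ord_recr b_last [X in _ = _ + X]addr0.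
  rewrite -[RHS]addrA -big_split.
  congr (_ + _).
    by rewrite /a /c muln0 !bin0 !subn0.
  apply: eq_bigr => t _; rewrite lift0 /a /b /c [(_ < _)%N](ltn_ord t) /=.
  have -> : (n - m * t - M = n.+1 - m * t.+1)%N by lia.
  (* The two arguments differ only through truncation, and then the binomial is 0. *)
  have aE : 'C(n, m * t.+1)%:R * pbell M (n - m * t.+1).+1 (k - t.+1)%N =
      'C(n, m * t.+1)%:R * pbell M (n.+1 - m * t.+1)%N (k - t.+1)%N.
    have [le|lt] := leqP (m * t.+1) n; first by rewrite subSn.
    by rewrite bin_small // !mul0r.
  have bE : ('C(n, m * t) * 'C(n - m * t, M) * blocks M t =
      'C(n, m * t + M) * ('C(M.+1 * t + M, M) * blocks M t))%N.
    by rewrite mul_bin_sub mulnA.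
  have mtE : (m * t.+1 = (m * t + M).+1)%N by lia.
  rewrite {1}mtE binS -mtE.
  transitivity ('C(M.+1 * t + M, M)%:R * (blocks M t)%:R * X m ^+ t.+1 *
    ('C(n, m * t.+1)%:R * pbell M (n.+1 - m * t.+1)%N (k - t.+1)%N) +
    ('C(n, m * t) * 'C(n - m * t, M) * blocks M t)%:R * X m ^+ t.+1 *
    pbell M (n.+1 - m * t.+1)%N (k - t.+1)%N).
    by rewrite bE !natrM natrD; ring.
  by rewrite -aE !natrM exprS; ring.
by rewrite sum_e sum_f -sum_ab [RHS]addrAC subrK.
Qed.

(** For n < M the extra term of [pbell_rec] vanishes with 'C(n, M), which leaves the recurrence of
    [bell]. *)
Lemma pbell_bell M n k : (forall j, (0 < j <= M)%N -> d (X j) = X j.+1) ->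
  (n <= M)%N -> pbell M n k = bell (X 1%N) d n k.
Proof.
move=> dX; elim: n k => [|n IH] k le_nM.
  elim: (M) k => [|m IHm] k /=; first by [].
  rewrite big_ord_recl big1 => [|t _]; last by rewrite bin0n mul0n !mul0r.
  by rewrite muln0 !subn0 !mul1r addr0 IHm.
have := pbell_rec n k dX.
case: k => [|k]; first by rewrite !addr0 /= add0r -IH //; lia.
by rewrite bin_small // !mul0r addr0 => ->; rewrite bellS addrC -!IH //; lia.
Qed.
End PartialBell.

(** * From the recursion on the block size to the sum over exponents *)

Section Explicit.
Variables (R : comNzRingType) (X : nat -> R).

(** The order of the group of permutations preserving a partition with r i blocks of size i + 1. *)
Definition block_auts M (r : 'I_M -> nat) : nat :=
  (\prod_i (r i)`! * \prod_(i < M) i.+1`! ^ r i)%N.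

(** Split off the largest blocks: a binomial coefficient separates their elements, and [blocks_fact]
    handles them. *)
Lemma dvdn_block_auts M (r : 'I_M -> nat) :
  (block_auts r %| (\sum_(i < M) i.+1 * r i)`!)%N.
Proof.
elim: M r => [|M IH] r; first by rewrite /block_auts !big_ord0.
have {IH} := IH (fun i => r (widen_ord (leqnSn M) i)).
rewrite /block_auts !big_ord_recr /=.
set s := (\sum_(i < M) _)%N; set p := (\prod_(i < M) _`!)%N.
set q := (\prod_(i < M) _)%N; set t := r ord_max => dvd.
have -> : (p * t`! * (q * M.+1`! ^ t) = p * q * (t`! * M.+1`! ^ t))%N by lia.
have/dvdn_trans : (p * q * (t`! * M.+1`! ^ t) %| s`! * (M.+1 * t)`!)%N.
  by apply: dvdn_mul => //; rewrite -blocks_fact dvdn_mull.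
apply; rewrite -[X in (X`! * _)%N](addnK (M.+1 * t)%N) mulnC.
by rewrite -(bin_fact (leq_addl s (M.+1 * t))) dvdn_mull.
Qed.

Definition fsnoc (T : finType) M (r : {ffun 'I_M -> T}) (t : T) :
  {ffun 'I_M.+1 -> T} := [ffun i => oapp r t (unlift ord_max i)].

Lemma big_ffun_recr (T : finType) M (V : nmodType)
    (P : pred {ffun 'I_M.+1 -> T}) (F : {ffun 'I_M.+1 -> T} -> V) :
  \sum_(r | P r) F r =
  \sum_(t : T) \sum_(r : {ffun 'I_M -> T} | P (fsnoc r t)) F (fsnoc r t).
Proof.
rewrite pair_big_dep /=.
rewrite (reindex (fun p : T * {ffun 'I_M -> T} => fsnoc p.2 p.1)) //.
exists (fun r : {ffun 'I_M.+1 -> T} =>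
    (r ord_max, [ffun i : 'I_M => r (lift ord_max i)])) => [[t r] _|r _] /=.
  congr pair; first by rewrite ffunE unlift_none.
  by apply/ffunP => i; rewrite !ffunE liftK.
apply/ffunP => i; rewrite !ffunE; case: unliftP => [j ->|->] //=.
by rewrite ffunE.
Qed.

Lemma fsnoc_widen (T : finType) M (r : {ffun 'I_M -> T}) t i :
  fsnoc r t (widen_ord (leqnSn M) i) = r i.
Proof.
have -> : widen_ord (leqnSn M) i = lift ord_max i.
  exact/val_inj/esym/lift_max.
by rewrite ffunE liftK.
Qed.

Lemma fsnoc_max (T : finType) M (r : {ffun 'I_M -> T}) t :
  fsnoc r t ord_max = t.
Proof. by rewrite ffunE unlift_none. Qed.

(** Exactness of the division, from [dvdn_block_auts], makes the quotients multiply as in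
    [pbellS]. *)
Lemma block_auts_snoc M (r : 'I_M.+1 -> nat) (r' : 'I_M -> nat) n :
    (forall i, r (widen_ord (leqnSn M) i) = r' i) ->
    ((\sum_(i < M.+1) i.+1 * r i)%N = n) ->
  (n`! %/ block_auts r =
    'C(n, M.+1 * r ord_max) * blocks M (r ord_max) *
    ((n - M.+1 * r ord_max)`! %/ block_auts r'))%N.
Proof.
move=> rr' <-; rewrite /block_auts !big_ord_recr /=.
under eq_bigr => i _ do rewrite rr'.
under [X in (_ %/ (X * _ * _))%N]eq_bigr => i _ do rewrite rr'.
under [X in (_ %/ (_ * (X * _)))%N]eq_bigr => i _ do rewrite rr'.
rewrite addnK; have := dvdn_block_auts r'; rewrite /block_auts.
set s := (\sum_(i < M) _)%N; set p := (\prod_(i < M) _`!)%N.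
set q := (\prod_(i < M) _)%N; set t := r ord_max => /dvdnP[z zE].
have p_gt0 : (0 < p)%N by rewrite prodn_gt0 // => i; exact: fact_gt0.
have q_gt0 : (0 < q)%N by rewrite prodn_gt0 // => i; rewrite expn_gt0 fact_gt0.
rewrite zE mulnK ?muln_gt0 ?p_gt0 //.
have -> : ((s + M.+1 * t)`! = 'C(s + M.+1 * t, M.+1 * t) * blocks M t * z *
    (p * t`! * (q * M.+1`! ^ t)))%N.
  rewrite -(bin_fact (leq_addl s (M.+1 * t))) addnK zE -blocks_fact; lia.
by rewrite mulnK // !muln_gt0 p_gt0 q_gt0 expn_gt0 !fact_gt0.
Qed.

(** The bound K on the exponents is kept apart from k, since the induction lowers k to k - t while
    the type of r must not change. *)
Lemma pbell_explicit M K n k : (k <= K)%N ->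
  \sum_(r : {ffun 'I_M -> 'I_K.+1}
      | ((\sum_i r i)%N == k) && ((\sum_(i < M) i.+1 * r i)%N == n))
    (n`! %/ block_auts (fun i => r i))%:R * \prod_(i < M) X i.+1 ^+ r i
  = pbell X M n k.
Proof.
elim: M n k => [|M IH] n k le_kK.
  rewrite (eq_bigl (fun=> (n == 0%N) && (k == 0%N))) => [|r]; last first.
    by rewrite !big_ord0 andbC eq_sym [RHS]andbC [X in _ && X]eq_sym andbC.
  rewrite /=; case: eqVneq => [->|_]; last by rewrite big_pred0.
  case: eqVneq => [_|_]; last by rewrite big_pred0.
  rewrite (eq_bigr (fun=> 1)) => [|r _]; last first.
    by rewrite /block_auts !big_ord0 mulr1.
  by rewrite sumr_const card_ffun !card_ord expn0.
pose term t := ('C(n, M.+1 * t) * blocks M t)%:R * X M.+1 ^+ t *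
  pbell X M (n - M.+1 * t)%N (k - t)%N.
rewrite big_ffun_recr pbellS (big_ord_widen K.+1 term) //.
rewrite [RHS]big_mkcond {}/term.
apply: eq_bigr => t _.
(* The two inequalities guard the truncated subtractions. *)
have condE (r : {ffun 'I_M -> 'I_K.+1}) :
    ((\sum_i fsnoc r t i)%N == k) &&
      ((\sum_(i < M.+1) i.+1 * fsnoc r t i)%N == n) =
    [&& (t <= k)%N, (M.+1 * t <= n)%N, (\sum_i r i)%N == (k - t)%N &
      (\sum_(i < M) i.+1 * r i)%N == (n - M.+1 * t)%N].
  rewrite !big_ord_recr /= !fsnoc_max.
  under eq_bigr => i _ do rewrite fsnoc_widen.
  under [in X in _ && X]eq_bigr => i _ do rewrite fsnoc_widen.
  set a := (\sum_i r i)%N; set b := (\sum_(i < M) _)%N; clear.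
  by move: {a}(a : nat) {b}(b : nat) => a b; lia.
rewrite (eq_bigl _ _ condE) ltnS.
have [le_tk|_] := leqP t k; last by rewrite big_pred0.
have [le_tn|lt_nt] := leqP (M.+1 * t) n; last first.
  by rewrite big_pred0 ?bin_small ?mul0r.
rewrite -IH; last by lia.
rewrite mulr_sumr; apply: eq_bigr => r; rewrite /= => /andP[_ /eqP wr].
rewrite (@block_auts_snoc M _ (fun i => r i)); first last.
- rewrite big_ord_recr /= fsnoc_max.
  under eq_bigr => i _ do rewrite fsnoc_widen.
  by rewrite wr subnK.
- by move=> i; rewrite fsnoc_widen.
rewrite big_ord_recr /= fsnoc_max !natrM.
under eq_bigr => i _ do rewrite fsnoc_widen.
by ring.
Qed.
End Explicit.

(** * The derivation X_j |-> X_(j+1) and the polynomials A *)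

Section Partials.
Variables (R : comNzRingType) (X : nat -> R) (p : nat -> R -> R) (y : R).
Hypothesis derp : forall j, derivation (p j).
Hypothesis pX : forall i j, p i.+1 (X j.+1) = (i == j)%:R.
Hypothesis p_comm : forall i j u, p i (p j u) = p j (p i u).
Hypothesis X1y : X 1%N * y = 1.

(** The derivation sending each X_j to X_(j+1) is an infinite sum of partial derivatives; the cut at
    N suffices for all indices n up to N. *)
Definition shift N (u : R) : R := \sum_(i < N) X i.+2 * p i.+1 u.

Lemma shift_derivation N : derivation (shift N).
Proof.
split=> u v; rewrite /shift.
  by rewrite -big_split; apply: eq_bigr => j _; rewrite (derD (derp _)) mulrDr.
rewrite mulr_suml mulr_sumr -big_split; apply: eq_bigr => j _.
by rewrite (derM (derp _)) /=; ring.
Qed.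

Lemma shiftX N j : (0 < j <= N)%N -> shift N (X j) = X j.+1.
Proof.
case: j => // j /andP[_ le_jN]; rewrite /shift (bigD1 (Ordinal le_jN)) //=.
rewrite pX eqxx mulr1 big1 ?addr0 // => i neq_ij.
by rewrite pX -[_ == j]/(i == Ordinal le_jN) (negPf neq_ij) mulr0.
Qed.

Lemma pX_neq i j : (0 < i)%N -> (0 < j)%N -> i != j -> p i (X j) = 0.
Proof.
by case: i j => [|i] [|j] // _ _; rewrite eqSS => /negPf neq; rewrite pX neq.
Qed.

Variable S : nat -> nat -> R.
Hypothesis S0 : forall k, S 0%N k = if k == 0%N then y else 0.
Hypothesis SS : forall n k, S n.+1 k =
  if (0 < k <= n.+1)%N then
    - (((2 * n)%:Z - 1)%:~R * X 2%N * S n k)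
    + X 1%N * (S n k.-1 + \sum_(1 <= j < (n.+1 - k).+1) X j.+1 * p j (S n k))
  else 0.

Lemma S_gt n k : (n < k)%N -> S n k = 0.
Proof.
by case: n k => [|n] [|k] // lt_nk; rewrite (S0, SS) //= ifF //; lia.
Qed.

(** Only X_1, ..., X_(n-k+1) occur in [S n k], so the bounded sum in [SS] can be completed to
    [shift N]. *)
Lemma p_S n k j : (0 < j)%N -> (n.+1 < j + k)%N -> p j (S n k) = 0.
Proof.
elim: n k j => [|n IH] k j j_gt0 lt_n; have derj := derp j.
  rewrite S0; case: k lt_n => [|k] lt_n; last exact: der0.
  by rewrite (der_inv derj X1y) pX_neq ?mulr0 ?oppr0 //; lia.
rewrite SS; case: ifP => [/andP[k_gt0 le_kn]|_]; last exact: der0.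
have pS0 : p j (S n k) = 0 by apply: IH; lia.
have pXS0 : p j (X 2%N * S n k) = 0.
  (* For j = 2 the bound gives n < k, and then [S n k] vanishes. *)
  rewrite (derM derj) pS0 mulr0 addr0; have [j2|neq] := eqVneq j 2%N.
    by rewrite S_gt ?mulr0 //; lia.
  by rewrite pX_neq ?mul0r.
have derZ (c : int) u : p j (c%:~R * u) = c%:~R * p j u.
  rewrite (derM derj); suff -> : p j c%:~R = 0 by rewrite mul0r add0r.
  case: c => c; first exact: (der_nat derj c).
  by rewrite -[_%:~R]/(- c.+1%:R) (derN derj) (der_nat derj) oppr0.
rewrite (derD derj) (derN derj) -mulrA derZ pXS0 mulr0 oppr0 add0r.
rewrite (derM derj) pX_neq //; last by lia.
rewrite mul0r add0r (derD derj) IH ?add0r; [|lia|lia].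
rewrite (der_sum derj) big_nat big1 ?mulr0 // => i /andP[i_gt0 lt_i].
rewrite (derM derj) p_comm pS0 (der0 (derp i)) mulr0 addr0.
by rewrite pX_neq ?mul0r //; lia.
Qed.

(** The factor stands for X_1^(1-2n); its derivative produces exactly the term -(2n-1) X_2 S(n,k) of
    the recurrence. *)
Lemma S_bell N n k : (n <= N)%N ->
  X 1%N * y ^+ (2 * n) * S n k = bell y (fun u => y * shift N u) n k.
Proof.
have dersh := shift_derivation N; have dersh' := derivation_scale y dersh.
elim: n k => [|n IH] k le_nN.
  by rewrite S0 /=; case: eqP => _; rewrite ?mulr0 // mulr1.
have [k_gt|le_k] := ltnP n.+1 k; first by rewrite S_gt // mulr0 bell_lt.
case: k le_k => [|k] le_k; first by rewrite SS mulr0 bell0.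
have -> : S n.+1 k.+1 = - (((2 * n)%:Z - 1)%:~R * X 2%N * S n k.+1)
     + X 1%N * (S n k +
        \sum_(1 <= j < (n.+1 - k.+1).+1) X j.+1 * p j (S n k.+1)).
  by rewrite SS le_k.
rewrite bellS -!IH; try lia.
have -> : \sum_(1 <= j < (n.+1 - k.+1).+1) X j.+1 * p j (S n k.+1) =
    shift N (S n k.+1).
  rewrite big_add1 /= /shift (big_nat_widen 0 _ N); last by lia.
  rewrite big_mkord [RHS](bigID (fun i : 'I_N => (i < n.+1 - k.+1)%N)) /=.
  rewrite [X in _ = _ + X]big1 ?addr0 // => i lt_i.
  by rewrite p_S ?mulr0 //; lia.
rewrite !(derM dersh) (derX dersh) (der_inv dersh X1y) shiftX; last by lia.
have y2n : (2 * n)%:R * y ^+ (2 * n).-1 * - (y ^+ 2 * X 2%N) =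
    - ((2 * n)%:R * y ^+ (2 * n) * y * X 2%N).
  by case: (2 * n)%N => [|m]; rewrite ?mul0r ?oppr0 // !exprS /=; ring.
have -> : (2 * n.+1 = (2 * n).+2)%N by lia.
have -> : ((2 * n)%:Z - 1)%:~R = (2 * n)%:R - 1 :> R by rewrite rmorphB.
rewrite [y ^+ (2 * n).+2]exprS [y ^+ (2 * n).+1]exprS.
transitivity ((X 1%N * y) * y ^+ (2 * n) *
  (y * (- (((2 * n)%:R - 1) * X 2%N * S n k.+1)) +
  (X 1%N * y) * (S n k + shift N (S n k.+1)))); first by ring.
rewrite X1y y2n.
transitivity ((X 1%N * y) * y ^+ (2 * n) * S n k +
  (y ^+ (2 * n) * y * X 2%N * S n k.+1
  - (X 1%N * y) * ((2 * n)%:R * y ^+ (2 * n) * y * X 2%N) * S n k.+1 +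
   (X 1%N * y) * y ^+ (2 * n) * shift N (S n k.+1))); last by ring.
by rewrite X1y; ring.
Qed.
End Partials.

(** Agreement of B with [bell] is required only up to 2n, since a truncated derivation gives no
    more. *)
Lemma bell_inversion (R : comUnitRingType) (y : R) (e : R -> R)
    (B : nat -> nat -> R) n k :
    derivation e -> y * y^-1 = 1 -> (0 < k)%N -> (k <= n)%N ->
    (forall i j, (i <= 2 * n)%N -> B i j = bell y e i j) ->
  bell y^-1 (fun u => y^-1 * e u) n k =
  \sum_(k.-1 <= r < n)
    (-1) ^+ (n - 1 - r)
    * ('C(2 * n - 2 - r, k - 1))%:R * ('C(2 * n - k, r + 1 - k))%:R
    * y^-1 ^+ (2 * n - 1 - r)
    * B (2 * n - 1 - k - r)%N (n - 1 - r)%N.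
Proof.
move=> dere yV; case: k => // k _ le_kn BE.
have [m nE] : {m | n = (m + k).+1} by exists (n - k.+1)%N; lia.
rewrite {}nE in BE *; rewrite (bell_inversion_shift dere yV).
(* Reversal makes s = n - 1 - r the summation index. *)
rewrite big_nat_rev sum_nat_shift [k.+1.-1]/= subSn ?leq_addl // addnK.
apply: eq_bigr => s _; have le_sm : (s <= m)%N by rewrite -ltnS.
have -> : (k + (m + k).+1 - (s + k).+1 = m + k - s)%N by lia.
have -> : ((m + k).+1 - 1 - (m + k - s) = s)%N by lia.
have -> : (2 * (m + k).+1 - 2 - (m + k - s) = m + k + s)%N by lia.
have -> : (k.+1 - 1 = k)%N by lia.
have -> : (2 * (m + k).+1 - k.+1 = (m + m + k).+1)%N by lia.
have -> : (m + k - s + 1 - k.+1 = m - s)%N by lia.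
have -> : (2 * (m + k).+1 - 1 - (m + k - s) = (m + k + s).+1)%N by lia.
have -> : (2 * (m + k).+1 - 1 - k.+1 - (m + k - s) = m + s)%N by lia.
by rewrite BE //; lia.
Qed.

Lemma bell_inversion_pair (R : comUnitRingType) (x : R) (d : R -> R)
    (A B : nat -> nat -> R) n k :
    derivation d -> x \is a GRing.unit -> (0 < k)%N -> (k <= n)%N ->
    (forall i j, (i <= 2 * n)%N ->
       A i j = bell x^-1 (fun u => x^-1 * d u) i j) ->
    (forall i j, (i <= 2 * n)%N -> B i j = bell x d i j) ->
  A n k =
    \sum_(k.-1 <= r < n)
       (-1) ^+ (n - 1 - r)
       * ('C(2 * n - 2 - r, k - 1))%:R * ('C(2 * n - k, r + 1 - k))%:R
       * x ^ (r%:Z - (2 * n)%:Z + 1)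
       * B (2 * n - 1 - k - r)%N (n - 1 - r)%N
  /\
  B n k =
    \sum_(k.-1 <= r < n)
       (-1) ^+ (n - 1 - r)
       * ('C(2 * n - 2 - r, k - 1))%:R * ('C(2 * n - k, r + 1 - k))%:R
       * x ^ ((2 * n)%:Z - 1 - r%:Z)
       * A (2 * n - 1 - k - r)%N (n - 1 - r)%N.
Proof.
move=> derd Ux k_gt0 le_kn AE BE; have le_n2n : (n <= 2 * n)%N by lia.
split.
  rewrite AE // (@bell_inversion _ _ _ B) //; last exact: mulrV.
  apply: eq_big_nat => r /andP[_ lt_rn]; congr (_ * _ * _).
  have -> : r%:Z - (2 * n)%:Z + 1 = - (2 * n - 1 - r)%N%:Z by lia.
  by rewrite exprVn exprnN.
have derd' := derivation_scale x^-1 derd.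
rewrite BE //.
(* Inverting the pair (x^-1, x^-1 d) once more returns (x, d), so the same lemma applies with A and
   B exchanged. *)
rewrite -(@eq_bell _ _ (fun u => x^-1^-1 * (x^-1 * d u))) => [|u]; last first.
  by rewrite invrK mulrA mulrV ?mul1r.
rewrite -{1}[x]invrK (@bell_inversion _ _ _ A) // ?mulrV ?unitrV //.
apply: eq_big_nat => r /andP[_ lt_rn]; congr (_ * _ * _).
have -> : (2 * n)%:Z - 1 - r%:Z = (2 * n - 1 - r)%N%:Z by lia.
by rewrite invrK.
Qed.

(** * [Bell] and [Apoly] as instances of [bell] *)

Lemma lpderiv_derivation j : derivation (lpderiv j).
Proof. by split; [exact: lpderivD | exact: lpderivM]. Qed.

Lemma lmon_down_comm i j m :
  lmon_down i (lmon_down j m) = lmon_down j (lmon_down i m).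
Proof.
case: m => a m; case: i j => [|[|i]] [|[|j]] //=.
by congr pair; apply/eqP/cmP => l; rewrite !divcmE; lia.
Qed.

Lemma lmon_exp_down i j m : i != j -> lmon_exp i (lmon_down j m) = lmon_exp i m.
Proof.
case: m => a m; case: i j => [|[|i]] [|[|j]] //= neq_ij.
rewrite divcmE ucmE [_ == _]eq_sym -[i == j]/(i.+2 == j.+2).
by rewrite (negPf neq_ij) subn0.
Qed.

(** On a monomial, lowering the exponent of X_j leaves that of X_i unchanged when i and j differ. *)
Lemma lpderiv_comm i j (p : lpoly) :
  lpderiv i (lpderiv j p) = lpderiv j (lpderiv i p).
Proof.
have [-> //|neq_ij] := eqVneq i j.
have -> : p = \sum_(m <- msupp p) (<< p@_m *g m >> : lpoly) by exact: monalgE.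
rewrite !lpderiv_sum; apply: eq_bigr => m _; rewrite !lpderivU.
rewrite lmon_down_comm lmon_exp_down // (@lmon_exp_down j i) 1?eq_sym //.
by rewrite mulrAC.
Qed.

Lemma lpX1V : lpX 1 * (lpX 1)^-1 = 1.
Proof. exact: mulrV lpX1_unit. Qed.

Lemma Bell_bell N n k : (n <= N)%N ->
  Bell n k = bell (lpX 1) (shift lpX lpderiv N) n k.
Proof.
move=> le_nN; have dersh := shift_derivation lpX lpderiv_derivation N.
rewrite -(@pbell_bell _ lpX _ dersh N) //; last exact: (shiftX lpderivX).
rewrite /Bell; case: eqVneq => [->|k_neq0].
  rewrite (pbell_bell dersh) //; last exact: (shiftX lpderivX).
  by rewrite (bell0 _ dersh).
case: ltnP => [lt_nk|le_kn]; first by rewrite pbell_lt.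
(* Among k nonempty blocks of an n-element set none exceeds n - k + 1, the bound used in [Bell]. *)
rewrite (@pbell_stable _ _ (n - k).+1); [|lia|lia].
exact: (@pbell_explicit _ lpX (n - k).+1 k n k (leqnn k)).
Qed.

Lemma Apoly_bell N n k : (n <= N)%N ->
  Apoly n k = bell (lpX 1)^-1 (fun u => (lpX 1)^-1 * shift lpX lpderiv N u) n k.
Proof.
move=> le_nN.
have SS m j : Spoly m.+1 j = if (0 < j <= m.+1)%N then
    - (((2 * m)%:Z - 1)%:~R * lpX 2%N * Spoly m j) + lpX 1%N * (Spoly m j.-1 +
      \sum_(1 <= i < (m.+1 - j).+1) lpX i.+1 * lpderiv i (Spoly m j)) else 0.
  by [].
rewrite -(S_bell lpderiv_derivation lpderivX lpderiv_comm lpX1V _ SS) //.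
congr (_ * _); rewrite exprzDr ?lpX1_unit //.
by rewrite expr1z -exprnN exprVn.
Qed.

Theorem theorem6p4 (n k : nat) (hk : (1 <= k)%N) (hkn : (k <= n)%N) :
  Apoly n k =
    \sum_(k.-1 <= r < n)
       (-1) ^+ (n - 1 - r)
       * ('C(2 * n - 2 - r, k - 1))%:R * ('C(2 * n - k, r + 1 - k))%:R
       * lpX 1 ^ (r%:Z - (2 * n)%:Z + 1)
       * Bell (2 * n - 1 - k - r) (n - 1 - r)
  /\
  Bell n k =
    \sum_(k.-1 <= r < n)
       (-1) ^+ (n - 1 - r)
       * ('C(2 * n - 2 - r, k - 1))%:R * ('C(2 * n - k, r + 1 - k))%:R
       * lpX 1 ^ ((2 * n)%:Z - 1 - r%:Z)
       * Apoly (2 * n - 1 - k - r) (n - 1 - r).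
Proof.
(* All first indices in both formulas are at most 2n, so the derivation may be cut there. *)
have dersh := shift_derivation lpX lpderiv_derivation (2 * n).
by apply: (bell_inversion_pair dersh lpX1_unit hk hkn) => i j le_i;
  [exact: Apoly_bell | exact: Bell_bell].
Qed.
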